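(* Let $N\ge 1$, let $R$ be a $(d+1)\times(d+1)$ matrix, and let $\bar R^{(N-1)}$ and $\bar R^{(N)}$ be its symmetric powers in degrees $N-1$ and $N$ respectively. Let $m$ be a multi-index with $|m|=N$ and $n$ a multi-index with $|n|=N-1$. Then for every $j\in\{0,\dots,d\}$, $$\sum_{k=0}^d m_k\,\bar R^{(N-1)}_{m-e_k,\,n}\,R_{kj}=(n_j+1)\,\bar R^{(N)}_{m,\,n+e_j}.$$
   Context: Matrices have complex entries, with rows and columns indexed by $0,1,\dots,d$. Multi-indices are tuples $n=(n_0,\dots,n_d)$ of nonnegative integers, $|n|=\sum_i n_i$, and $x^n=x_0^{n_0}\cdots x_d^{n_d}$ for commuting variables $x=(x_0,\dots,x_d)$. $e_k$ denotes the multi-index with $1$ in position $k$ and $0$ elsewhere. For a $(d+1)\times(d+1)$ matrix $A$ and an integer $N\ge 0$, with $(Ax)_i=\sum_j A_{ij}x_j$, the symmetric power $\bar A^{(N)}$ of $A$ in degree $N$ is the matrix indexed by multi-indices $m,n$ with $|m|=|n|=N$ defined by $(Ax)^m=\sum_{|n|=N}\bar A^{(N)}_{mn}x^n$. A term of the sum with $m_k=0$ (for which $m-e_k$ is not a multi-index) is interpreted as $0$. *)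

(* Defs.v *)
From HB Require Import structures.
From mathcomp Require Import all_boot all_order all_algebra.
From mathcomp Require Export complex reals.
From mathcomp Require Export mpoly.

Set Implicit Arguments.
Unset Strict Implicit.
Unset Printing Implicit Defensive.

Import GRing.Theory.
Local Open Scope ring_scope.

Section SymmetricPower.
Variables (C : comNzRingType) (d : nat).
Implicit Types (A : 'M[C]_d.+1) (m n : 'X_{1..d.+1}).

(* (Ax)_i as a polynomial in the commuting variables x_0, ..., x_d *)
Definition mxvar A (i : 'I_d.+1) : {mpoly C[d.+1]} :=
  \sum_(j < d.+1) A i j *: 'X_j.

(* (Ax)^m *)
Definition mxmonom A m : {mpoly C[d.+1]} :=
  \prod_(i < d.+1) mxvar A i ^+ m i.

(* The (m, n) entry of the symmetric power of A in degree N, i.e. the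
   coefficient of x^n in (Ax)^m. The index set is {m | mdeg m = N}; entries are
   set to 0 outside it. [sympowE] and [sympow_unique] say that this is the only
   matrix satisfying (Ax)^m = \sum_(|n| = N) sympow N A m n x^n for |m| = N. *)
Definition sympow (N : nat) A m n : C :=
  if (mdeg m == N) && (mdeg n == N) then (mxmonom A m)@_n else 0.

Lemma mxmonom_homog A m : mxmonom A m \is (mdeg m).-homog.
Proof.
rewrite mdegE /mxmonom.
elim/big_ind2: _ => [|p a q b hp hq|i _]; first exact: dhomog1.
  exact: dhomogM.
rewrite -[m i in X in X.-homog]mul1n; apply: dhomogMn.
by apply: rpred_sum => j _; apply: dhomogZ; rewrite dhomogX; apply/eqP/mdeg1.
Qed.

Lemma sympowE N A m : mdeg m = N ->
  mxmonom A m
  = \sum_(n : 'X_{1..d.+1 < N.+1} | mdeg n == N) sympow N A m n *: 'X_[n].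
Proof.
move=> mN; apply/mpolyP => k; rewrite raddf_sum /=.
have [kN|kN] := eqVneq (mdeg k) N; last first.
  rewrite (dhomog_nemf_coeff (mxmonom_homog A m)) ?mN // big1 // => n /eqP nN.
  rewrite mcoeffZ mcoeffX; case: eqP => [nk|_]; last by rewrite mulr0.
  by rewrite -nk nN eqxx in kN.
have kb : (mdeg k < N.+1)%N by rewrite kN.
rewrite (bigD1 (BMultinom kb)) ?kN //= mcoeffZ mcoeffX eqxx mulr1.
rewrite /sympow mN kN eqxx big1 ?addr0 // => n /andP[_ nk].
by rewrite mcoeffZ mcoeffX -[_ == k]/(n == BMultinom kb) (negPf nk) mulr0.
Qed.

Lemma sympow_unique N A m (S : 'X_{1..d.+1} -> C) : mdeg m = N ->
    mxmonom A m = \sum_(n : 'X_{1..d.+1 < N.+1} | mdeg n == N) S n *: 'X_[n] ->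
  forall n, mdeg n = N -> S n = sympow N A m n.
Proof.
move=> mN mE k kN; rewrite /sympow mN kN eqxx mE raddf_sum /=.
have kb : (mdeg k < N.+1)%N by rewrite kN.
rewrite (bigD1 (BMultinom kb)) ?kN //= mcoeffZ mcoeffX eqxx mulr1.
rewrite big1 ?addr0 // => n /andP[_ nk].
by rewrite mcoeffZ mcoeffX -[_ == k]/(n == BMultinom kb) (negPf nk) mulr0.
Qed.

End SymmetricPower.

(* Main.v *)
Require Import Defs.
From mathcomp Require Import all_boot all_order all_algebra.

(** Differentiate the generating polynomial [(Rx)^m] with respect to [x_j] and
    compare coefficients of [x^n]. Differentiation shifts coefficients, so the
    coefficient of [x^n] in the derivative is [n_j + 1] times that of
    [x^(n + e_j)] in [(Rx)^m], which is the right-hand side. On the other hand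
    the derivative of the linear form [(Rx)_k] is the constant [R k j], so the
    Leibniz rule writes the derivative as the sum over [k] of
    [m_k * R k j * (Rx)^(m - e_k)] ([mderiv_mxmonom]), whose coefficient of
    [x^n] is the left-hand side. *)

Set Implicit Arguments.
Unset Strict Implicit.
Unset Printing Implicit Defensive.

Import GRing.Theory.
Local Open Scope ring_scope.

Section LeibnizRule.
Variables (C : comNzRingType) (n : nat).

Lemma mderiv_exp (j : 'I_n) (p : {mpoly C[n]}) e :
  (p ^+ e)^`M(j) = (p ^+ e.-1 * p^`M(j)) *+ e.
Proof.
elim: e => [|e IHe]; first by rewrite expr0 mulr0n -mpolyC1 mderivC.
rewrite exprS mderivM IHe [p^`M(j) * _]mulrC mulrnAr mulrA.
case: e {IHe} => [|e]; first by rewrite !mulr0n addr0.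
by rewrite -exprS -mulrS.
Qed.

Lemma mderiv_prod (j : 'I_n) (I : finType) (f : I -> {mpoly C[n]}) :
  (\prod_i f i)^`M(j) = \sum_k (f k)^`M(j) * \prod_(i | i != k) f i.
Proof.
(* Along a list, [i != k] removes exactly one factor only if the list has no
   duplicates, so uniqueness is carried through the induction. *)
suff gen (s : seq I) : uniq s ->
    (\prod_(i <- s) f i)^`M(j)
    = \sum_(k <- s) (f k)^`M(j) * \prod_(i <- s | i != k) f i.
  by apply: gen; rewrite index_enum_uniq.
elim: s => [|a s IHs]; first by rewrite !big_nil -mpolyC1 mderivC.
case/andP=> a_s s_uniq; rewrite !big_cons mderivM IHs // eqxx; congr (_ + _).
  congr (_ * _); rewrite [LHS]big_seq [RHS]big_seq_cond; apply: eq_bigl => i.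
  by case: eqP => [->|_]; rewrite ?andbT // (negPf a_s).
rewrite mulr_sumr [LHS]big_seq [RHS]big_seq; apply: eq_bigr => k ks.
by rewrite big_cons ifT 1?mulrCA //; apply: contraNneq a_s => ->.
Qed.

End LeibnizRule.

Section DerivativeOfSymmetricPower.
Variables (C : comNzRingType) (d : nat).
Implicit Types (A : 'M[C]_d.+1) (m : 'X_{1..d.+1}).

Lemma mderiv_mxvar A i (j : 'I_d.+1) : (mxvar A i)^`M(j) = (A i j)%:MP.
Proof.
rewrite /mxvar raddf_sum (bigD1 j) //= big1 ?addr0 => [|k kj].
  by rewrite mderivZ mderivX mnm1E eqxx -[X in (X - _)%MM]add0m addmK mpolyX0 scale1r
    alg_mpolyC.
by rewrite mderivZ mderivX mnm1E (negPf kj) scale0r scaler0.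
Qed.

(** Each linear form has constant derivative, so the Leibniz and power rules
    give this. The terms with [m k = 0] vanish because of the factor [m k]; leaving them
    out keeps [m - U_(k)] from being a truncated subtraction. *)
Lemma mderiv_mxmonom A m (j : 'I_d.+1) :
  (mxmonom A m)^`M(j)
  = \sum_(k < d.+1 | (0 < m k)%N)
      ((m k)%:R * A k j) *: mxmonom A (m - U_(k))%MM.
Proof.
rewrite mderiv_prod [RHS]big_mkcond; apply: eq_bigr => k _.
rewrite mderiv_exp mderiv_mxvar.
case: posnP => [->|mk_gt0]; first by rewrite mulr0n mul0r.
rewrite /mxmonom [in RHS](bigD1 k) //= mnmBE mnm1E eqxx subn1.
have -> : \prod_(i | i != k) mxvar A i ^+ (m - U_(k))%MM i
          = \prod_(i | i != k) mxvar A i ^+ m i.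
  by apply: eq_bigr => i ik; rewrite mnmBE mnm1E eq_sym (negPf ik) subn0.
rewrite -scalerA scaler_nat -mul_mpolyC mulrnAl mulrA.
by rewrite [_%:MP * _]mulrC.
Qed.

End DerivativeOfSymmetricPower.

Theorem proposition2p8 (F : realType) (d N : nat) (R : 'M[F[i]]_d.+1)
    (m n : 'X_{1..d.+1}) (j : 'I_d.+1) :
  (1 <= N)%N -> mdeg m = N -> mdeg n = N.-1 ->
  \sum_(k < d.+1 | (0 < m k)%N)
     (m k)%:R * sympow N.-1 R (m - U_(k))%MM n * R k j
  = (n j + 1)%:R * sympow N R m (n + U_(j))%MM.
Proof.
move=> N_gt0 mN nN.
rewrite /sympow mN mdegD mdeg1 nN !addn1 prednK // !eqxx /=.
rewrite mulr_natl -mcoeff_mderiv mderiv_mxmonom raddf_sum /=.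
apply: eq_bigr => k mk_gt0; rewrite mcoeffZ.
have -> : mdeg (m - U_(k))%MM = N.-1.
  by rewrite -mN -[in RHS](@submK _ U_(k) m) ?lep1mP -?lt0n // mdegD mdeg1 addn1.
by rewrite eqxx mulrAC.
Qed.
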